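(* Let $X$ be a Banach space such that $C([0,1]^d)$ is continuously embedded in $X$, and let $\mathcal K\subset X$ be compact. Let $\sigma$ be an $L$-Lipschitz sigmoidal function or $\mathrm{ReLU}$ (with $L=1$ in the latter case), and let the bound $w$ on the network parameters satisfy $w(n)\ge1$ and $LWw(n)\ge 2$. Let $\alpha>0$ and $\beta\in\mathbb R$. Then $$\epsilon_n(\mathcal K)_X\gtrsim\frac{(\log_2 n)^\beta}{n^{\alpha}},\ n\in\mathbb N\ \Rightarrow\ E(\mathcal K,\Sigma_{n,\sigma}(w(n)))_X\gtrsim\frac{[\log_2 n+\log_2(1+\log_2w(n))]^{\beta}}{[n^2(1+\log_2w(n))]^{\alpha}},\ n\in\mathbb N,$$ $$\epsilon_n(\mathcal K)_X\gtrsim[\log_2 n]^{-\alpha},\ n\in\mathbb N\ \Rightarrow\ E(\mathcal K,\Sigma_{n,\sigma}(w(n)))_X\gtrsim[\log_2 n+\log_2(1+\log_2w(n))]^{-\alpha},\ n\in\mathbb N.$$ In particular, if $w(n)=Cn^\delta$ with $C,\delta>0$, then $$\epsilon_n(\mathcal K)_X\gtrsim[\log_2 n]^\beta n^{-\alpha}\ \Rightarrow\ E(\mathcal K,\Sigma_{n,\sigma}(Cn^\delta))_X\gtrsim[\log_2 n]^{\beta-\alpha}n^{-2\alpha},$$ $$\epsilon_n(\mathcal K)_X\gtrsim[\log_2 n]^{-\alpha}\ \Rightarrow\ E(\mathcal K,\Sigma_{n,\sigma}(Cn^\delta))_X\gtrsim[\log_2 n]^{-\alpha},$$ and if $w(n)=C2^{cn^\nu}$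 with $C,c>0$, $\nu\ge0$, then $$\epsilon_n(\mathcal K)_X\gtrsim[\log_2 n]^\beta n^{-\alpha}\ \Rightarrow\ E(\mathcal K,\Sigma_{n,\sigma}(C2^{cn^\nu}))_X\gtrsim[\log_2 n]^{\beta}n^{-(2+\nu)\alpha},$$ $$\epsilon_n(\mathcal K)_X\gtrsim[\log_2 n]^{-\alpha}\ \Rightarrow\ E(\mathcal K,\Sigma_{n,\sigma}(C2^{cn^\nu}))_X\gtrsim[\log_2 n]^{-\alpha}.$$
   Context: Deep neural networks. Fix $d\ge1$, a width $W\geq 2$, and an activation function $\sigma:\mathbb R\to\mathbb R$ which is either $\mathrm{ReLU}(t)=\max\{0,t\}$ (then $L:=1$), or an $L$-Lipschitz sigmoidal function; the only properties of the latter that are used are $|\sigma(t)|\le 1$ and $|\sigma(t_1)-\sigma(t_2)|\le L|t_1-t_2|$ for all $t,t_1,t_2\in\mathbb R$. Let $\bar\sigma:\mathbb R^W\to\mathbb R^W$ be $\sigma$ applied coordinatewise. For depth $n\ge1$ consider affine mappings $A^{(0)}:\mathbb R^d\to\mathbb R^W$, $A^{(\ell)}:\mathbb R^W\to\mathbb R^W$ ($\ell=1,\dots,n-1$), $A^{(n)}:\mathbb R^W\to\mathbb R$; let $y\in\mathbb R^{\tilde n}$ list in a fixed order all entries of their matrices and offset vectors, $\tilde n=W(d+1)+(n-1)W(W+1)+W+1$. Define on $[0,1]^d$ the function $\Phi_\sigma(y):=A^{(n)}\circ\bar\sigma\circ A^{(n-1)}\circ\cdots\circ\bar\sigma\circ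 A^{(0)}$. Put $\Sigma_{n,\sigma}(w(n)):=\{\Phi_\sigma(y):\|y\|_{\ell_\infty^{\tilde n}}\le w(n)\}$, $E(f,\Sigma_{n,\sigma}(w(n)))_X:=\inf_{\|y\|_{\ell_\infty^{\tilde n}}\le w(n)}\|f-\Phi_\sigma(y)\|_X$, and $E(\mathcal K,\Sigma_{n,\sigma}(w(n)))_X:=\sup_{f\in\mathcal K}E(f,\Sigma_{n,\sigma}(w(n)))_X$, $n\ge1$. The width $W$ is fixed while $n\to\infty$. Entropy numbers: $\epsilon_n(\mathcal K)_X$, $n\ge0$, is the infimum of all $\epsilon>0$ for which $\mathcal K$ is covered by $2^n$ balls of radius $\epsilon$ with centers in $X$. Asymptotic notation: for expressions $A,B$ depending on $n$, $A\gtrsim B$ means that there is a constant $c>0$ independent of $n$ with $A\ge cB$ as $n\to\infty$ (i.e. for all sufficiently large $n$, so that the logarithmic expressions are well defined). *)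

(* Defs.v *)
(* MathComp-Analysis, over an arbitrary [R : realType]. *)
From HB Require Import structures.
From mathcomp Require Export all_boot all_order all_algebra.
From mathcomp Require Export all_classical all_reals all_analysis.
Export Order.TTheory GRing.Theory Num.Theory.
Export numFieldNormedType.Exports.

Set Implicit Arguments.
Unset Strict Implicit.
Unset Printing Implicit Defensive.

Local Open Scope classical_set_scope.
Local Open Scope ring_scope.

Definition log2 (R : realType) (x : R) : R := ln x / ln 2.

Definition gtrsim (R : realType) (A : nat -> \bar R) (B : nat -> R) : Prop :=
  exists2 c : R, 0 < c & \forall n \near \oo, ((c * B n)%:E <= A n)%E.

Definition cube (R : realType) (d : nat) : set 'cV[R]_d :=
  [set x | forall i, 0 <= x i 0 <= 1].
Arguments cube : clear implicits.

Definition cts_on_cube (R : realType) (d : nat) (f : 'cV[R]_d -> R) : Prop :=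
  {within cube R d, continuous f}.

Definition sup_norm (R : realType) (d : nat) (f : 'cV[R]_d -> R) : R :=
  sup [set `|f x| | x in cube R d].

(* A continuous linear injection of C([0,1]^d) into X.  An element of
   C([0,1]^d) is represented by any function on R^d which is continuous within
   the cube; by linearity and boundedness [iota f] depends only on the
   restriction of [f] to the cube.  Nothing is assumed on [iota f] for the
   other functions [f]. *)
Definition continuous_embedding (R : realType) (d : nat) (X : normedModType R)
    (iota : ('cV[R]_d -> R) -> X) : Prop :=
  [/\ (forall (a : R) (f g : 'cV[R]_d -> R), cts_on_cube f -> cts_on_cube g ->
         iota (fun x => a * f x + g x) = a *: iota f + iota g),
      (forall f g : 'cV[R]_d -> R, cts_on_cube f -> cts_on_cube g ->
         iota f = iota g -> forall x, cube R d x -> f x = g x) &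
      (exists2 c : R, 0 < c & forall f : 'cV[R]_d -> R, cts_on_cube f ->
         `|iota f| <= c * sup_norm f)].

Definition relu (R : realType) (t : R) : R := Num.max 0 t.

(* Of a sigmoidal function, only the bound by 1 and the Lipschitz condition
   are required; no limits at infinity or monotonicity. *)
Definition lipschitz_sigmoidal (R : realType) (L : R) (sigma : R -> R) : Prop :=
  (forall t, `|sigma t| <= 1) /\
  (forall t1 t2, `|sigma t1 - sigma t2| <= L * `|t1 - t2|).

Definition admissible_activation (R : realType) (L : R) (sigma : R -> R) : Prop :=
  (sigma = @relu R /\ L = 1) \/ lipschitz_sigmoidal L sigma.

(* The affine map with matrix A and offset b is given by the block matrix
   [A | b]. *)
Definition affine_map (R : realType) (p k : nat) (M : 'M[R]_(p, k + 1))
    (x : 'cV[R]_k) : 'cV[R]_p :=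
  lsubmx M *m x + rsubmx M.

Definition num_params (d W n : nat) : nat :=
  (W * (d + 1) + n.-1 * (W * (W + 1)) + (W + 1))%N.

Section Network.
Variables (R : realType) (d W n : nat) (sigma : R -> R).
Variable (y : 'rV[R]_(num_params d W n)).

Definition first_layer : 'M[R]_(W, d + 1) := vec_mx (lsubmx (lsubmx y)).

(* [middle_layer l] is the affine map A^(l+1), for l = 0, ..., n - 2. *)
Definition middle_layer (l : 'I_n.-1) : 'M[R]_(W, W + 1) :=
  vec_mx (row l (vec_mx (rsubmx (lsubmx y)))).

Definition last_layer : 'M[R]_(1, W + 1) := rsubmx y.

Definition Phi (x : 'cV[R]_d) : R :=
  affine_map last_layer
    (map_mx sigma
       (foldl (fun z l => affine_map (middle_layer l) (map_mx sigma z))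
              (affine_map first_layer x)
              (enum 'I_n.-1))) 0 0.

End Network.

(* On row vectors the norm [`|y|] is the max norm. *)
Definition approx_error (R : realType) (d W : nat) (X : normedModType R)
    (iota : ('cV[R]_d -> R) -> X) (sigma : R -> R) (n : nat) (w : R) (f : X) :
    \bar R :=
  ereal_inf [set `|f - iota (Phi sigma y)|%:E |
              y in [set y : 'rV[R]_(num_params d W n) | `|y| <= w]].

Definition class_error (R : realType) (d W : nat) (X : normedModType R)
    (iota : ('cV[R]_d -> R) -> X) (sigma : R -> R) (K : set X) (n : nat) (w : R) :
    \bar R :=
  ereal_sup [set approx_error W iota sigma n w f | f in K].

Definition entropy_number (R : realType) (X : normedModType R) (K : set X)
    (n : nat) : \bar R :=
  ereal_inf [set e%:E | e in [set e : R | 0 < e /\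
    exists c : 'I_(2 ^ n) -> X, K `<=` \bigcup_i ball (c i) e]].

(* Main.v *)
(* Inputs and weights being bounded, each layer multiplies both the size of the
   hidden values and their Lipschitz constant in the parameters by at most a
   fixed multiple q of the weight bound w; hence y |-> Phi(y) is Lipschitz from
   the max norm to the sup norm on the cube with constant q^(n+1).  A grid of
   2^k points per parameter with k of order n (1 + log2 w) therefore gives a
   2^(-n (1 + log2 w))-net of the networks, so that K is covered by 2^m balls of
   radius E + 2^(-n (1 + log2 w)) with m of order n^2 (1 + log2 w).  The second
   summand decays faster than any power of m, and the lower bound on the
   entropy number of index m passes to E.  The statements with the rate
   (log2 n)^(-alpha) are the case where the exponent of n is 0. *)
Require Import Defs.
From mathcomp Require Import ring lra zify.

Set Implicit Arguments.
Unset Strict Implicit.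
Unset Printing Implicit Defensive.

Local Open Scope classical_set_scope.
Local Open Scope ring_scope.

(** * Networks as functions of their parameters *)

Lemma mx_norm_leP (R : realType) (m n : nat) (y : 'M[R]_(m, n)) (w : R) :
  0 <= w -> reflect (forall i j, `|y i j| <= w) (`|y| <= w).
Proof.
have -> : `|y| = mx_norm y by []. rewrite mx_normrE => w0.
apply: (iffP (bigmax_leP _ _ _ _)) => [[_ h] i j|h]; first exact: (h (i, j)).
by split => // -[i j] _; exact: h.
Qed.

Section Lipschitz.
Variables (R : realType).

Lemma affine_mapE p k (M : 'M[R]_(p, k + 1)) (z : 'cV[R]_k) i :
  affine_map M z i 0 =
  \sum_j M i (lshift 1 j) * z j 0 + M i (rshift k 0).
Proof. by rewrite !mxE; congr +%R; apply: eq_bigr => j _; rewrite !mxE. Qed.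

Lemma affine_map_bound p k (M : 'M[R]_(p, k + 1)) (z : 'cV[R]_k) (w B : R) i :
  (forall i j, `|M i j| <= w) -> (forall j, `|z j 0| <= B) ->
  `|affine_map M z i 0| <= k%:R * (w * B) + w.
Proof.
move=> hM hz; rewrite affine_mapE (le_trans (ler_normD _ _))// lerD//.
rewrite (le_trans (ler_norm_sum _ _ _))// mulr_natl.
rewrite -[X in _ *+ X]card_ord -sumr_const ler_sum// => j _.
by rewrite normrM ler_pM.
Qed.

Lemma affine_map_dist p k (M M' : 'M[R]_(p, k + 1)) (z z' : 'cV[R]_k)
    (w B D e : R) i :
  (forall i j, `|M' i j| <= w) -> (forall j, `|z j 0| <= B) ->
  (forall i j, `|M i j - M' i j| <= e) -> (forall j, `|z j 0 - z' j 0| <= D) ->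
  `|affine_map M z i 0 - affine_map M' z' i 0| <= k%:R * (e * B + w * D) + e.
Proof.
move=> hM' hz hM hzz'; rewrite !affine_mapE opprD addrACA -sumrB.
rewrite (le_trans (ler_normD _ _))// lerD//.
rewrite (le_trans (ler_norm_sum _ _ _))// mulr_natl.
rewrite -[X in _ *+ X]card_ord -sumr_const ler_sum// => j _.
have -> : M i (lshift 1 j) * z j 0 - M' i (lshift 1 j) * z' j 0 =
  (M i (lshift 1 j) - M' i (lshift 1 j)) * z j 0 +
  M' i (lshift 1 j) * (z j 0 - z' j 0) by ring.
by rewrite (le_trans (ler_normD _ _))// !normrM lerD// ler_pM.
Qed.

Variables (d W n : nat) (sigma : R -> R).
Implicit Types y : 'rV[R]_(num_params d W n).

Lemma layers_dist y y' (e : R) : `|y - y'| <= e ->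
  [/\ forall i j, `|first_layer y i j - first_layer y' i j| <= e,
      forall l i j, `|middle_layer y l i j - middle_layer y' l i j| <= e &
      forall i j, `|last_layer y i j - last_layer y' i j| <= e].
Proof.
move=> h; have /(mx_norm_leP _ (le_trans (normr_ge0 _) h)) {}h := h.
by split=> [i j|l i j|i j]; rewrite !mxE; apply: le_trans (h _ _); rewrite !mxE.
Qed.

(* Satisfied by ReLU (through [`|t|]) as well as by sigmoidal functions
   (through [1]). *)
Hypothesis sigma_bound : forall t, `|sigma t| <= Num.max 1 `|t|.
Variable L : R.
Hypothesis L1 : 1 <= L.
Hypothesis sigma_lip : forall t s, `|sigma t - sigma s| <= L * `|t - s|.

(** The fold inside [Phi] along an arbitrary list of layers, so that estimates can be proved by
    induction on the last layer. *)
Definition hidden y (s : seq 'I_n.-1) (x : 'cV[R]_d) : 'cV[R]_W :=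
  foldl (fun z l => affine_map (middle_layer y l) (map_mx sigma z))
        (affine_map (first_layer y) x) s.

(* The factor 3 absorbs the three terms of [affine_map_dist]: weight
   perturbation, propagated error and offset perturbation. *)
Definition lip_base (w : R) : R := 3 * (d%:R + 1) * (L * W%:R * w).

Lemma hidden_rcons y s l x : hidden y (rcons s l) x =
  affine_map (middle_layer y l) (map_mx sigma (hidden y s x)).
Proof. by rewrite /hidden -cats1 foldl_cat. Qed.

Variable w : R.
Hypothesis (w1 : 1 <= w) (W1 : (1 <= W)%N).

(** Every term of the layer estimates is dominated by [L * W%:R * w], which the arithmetic below
    treats as a single variable. *)
Let LWw_facts : [/\ 1 <= L * W%:R * w, w <= L * W%:R * w, W%:R <= L * W%:R * w &
  W%:R * w <= L * W%:R * w].
Proof.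
have W1' : (1 : R) <= W%:R by rewrite ler1n.
have Ww : W%:R <= W%:R * w by rewrite ler_peMr// (le_trans ler01).
have LWw : W%:R * w <= L * (W%:R * w).
  by rewrite ler_peMl// mulr_ge0// ?(le_trans ler01).
have wW : w <= W%:R * w by rewrite ler_peMl// (le_trans ler01).
by rewrite -mulrA; split; lra.
Qed.

Lemma lip_base_ge1 : 1 <= lip_base w.
Proof.
have [h _ _ _] := LWw_facts; have := ler0n R d; rewrite /lip_base.
by move: h; set a := L * _ * _; nra.
Qed.

(** Since the base is at least 1, the alternative 1 in the bound on [sigma] costs nothing. *)
Lemma sigma_hidden_le (m : nat) (t : R) :
  `|t| <= lip_base w ^+ m -> `|sigma t| <= lip_base w ^+ m.
Proof.
move=> h; apply: le_trans (sigma_bound _) _; rewrite ge_max h andbT.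
by rewrite exprn_ege1// lip_base_ge1.
Qed.

Lemma layers_le y : `|y| <= w ->
  [/\ forall i j, `|first_layer y i j| <= w,
      forall l i j, `|middle_layer y l i j| <= w &
      forall i j, `|last_layer y i j| <= w].
Proof.
move=> h; have /(mx_norm_leP _ (le_trans (normr_ge0 _) h)) {}h := h.
by split=> [i j|l i j|i j]; rewrite !mxE; apply: le_trans (h _ _).
Qed.

Lemma cube_norm_le (x : 'cV[R]_d) : cube R d x -> forall j, `|x j 0| <= 1.
Proof. by move=> hx j; have /andP[x0 x1] := hx j; rewrite ger0_norm. Qed.

(** Inputs are at most 1, so the first layer gives at most [d w + w]; each later layer multiplies
    the size by at most [W w + w]. Both factors are at most [lip_base w]. *)
Lemma hidden_bound y x s i : `|y| <= w -> cube R d x ->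
  `|hidden y s x i 0| <= lip_base w ^+ (size s).+1.
Proof.
move=> /layers_le[h1 h2 _] /cube_norm_le hx.
have [a1 a2 a3 a4] := LWw_facts.
have d0 := ler0n R d.
elim/last_ind: s i => [|s l IH] i.
  apply: le_trans (affine_map_bound _ h1 hx) _.
  by move: a1 a2 a3 a4; rewrite expr1 /lip_base; set a := L * _ * _; nra.
rewrite hidden_rcons size_rcons.
apply: le_trans (affine_map_bound (B := lip_base w ^+ (size s).+1) _ (h2 l) _) _.
  by move=> j; rewrite mxE sigma_hidden_le.
rewrite [leRHS]exprS.
have : 1 <= lip_base w ^+ (size s).+1 by rewrite exprn_ege1// lip_base_ge1.
set B := _ ^+ _ => B1.
suff h : W%:R * w + w <= lip_base w.
  apply: (@le_trans _ _ ((W%:R * w + w) * B)); last by rewrite ler_wpM2r// (le_trans ler01).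
  by rewrite mulrDl mulrA lerD2l ler_peMr// (le_trans ler01).
by move: a1 a2 a3 a4; rewrite /lip_base; set a := L * _ * _; nra.
Qed.

(** One application of [affine_map_dist] with hidden values at most [B] and incoming error
    [L * (B * e)]: the same [B] serves as size and as Lipschitz constant, so a layer costs one
    factor [lip_base w]. *)
Lemma layer_dist_step (B e : R) : 1 <= B -> 0 <= e ->
  W%:R * (e * B + w * (L * (B * e))) + e <= lip_base w * B * e.
Proof.
move=> B1 e0; have [a1 a2 a3 a4] := LWw_facts.
have -> : W%:R * (e * B + w * (L * (B * e))) + e =
  (W%:R + L * W%:R * w) * (B * e) + e by ring.
have d0 := ler0n R d.
have le1 : W%:R + L * W%:R * w + 1 <= lip_base w.
  by move: a1 a2 a3 a4; rewrite /lip_base; set a := L * _ * _; nra.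
have : e <= B * e by rewrite ler_peMl.
have : 0 <= B * e by nra.
rewrite -mulrA; nra.
Qed.

Lemma hidden_dist y y' x s i e : `|y| <= w -> `|y'| <= w -> `|y - y'| <= e ->
  cube R d x ->
  `|hidden y s x i 0 - hidden y' s x i 0| <= lip_base w ^+ (size s).+1 * e.
Proof.
move=> yw y'w yy' hx.
have e0 : 0 <= e by exact: le_trans yy'.
have [h1 h2 _] := layers_dist yy'.
have [h1' h2' _] := layers_le y'w.
elim/last_ind: s i => [|s l IH] i.
  (* Both networks receive the same input, hence no propagated error: [D = 0]. *)
  apply: le_trans (affine_map_dist (w := w) (D := 0) _ h1' (cube_norm_le hx) h1 _) _.
    by move=> j; rewrite subrr normr0.
  have [a1 a2 a3 a4] := LWw_facts; have d0 := ler0n R d.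
  suff : d%:R + 1 <= lip_base w by rewrite expr1; nra.
  by move: a1 a2 a3 a4; rewrite /lip_base; set a := L * _ * _; nra.
rewrite !hidden_rcons size_rcons.
apply: le_trans (affine_map_dist (B := lip_base w ^+ (size s).+1)
   (D := L * (lip_base w ^+ (size s).+1 * e)) _ (h2' l) _ (h2 l) _) _.
- by move=> j; rewrite mxE sigma_hidden_le// hidden_bound.
- move=> j; rewrite !mxE (le_trans (sigma_lip _ _))// ler_pM2l//.
  exact: lt_le_trans ltr01 L1.
- rewrite [leRHS](_ : _ = lip_base w * lip_base w ^+ (size s).+1 * e); last first.
    by rewrite exprS.
  by rewrite layer_dist_step// exprn_ege1// lip_base_ge1.
Qed.

Lemma Phi_dist y y' x e : (1 <= n)%N ->
  `|y| <= w -> `|y'| <= w -> `|y - y'| <= e -> cube R d x ->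
  `|Phi sigma y x - Phi sigma y' x| <= lip_base w ^+ n.+1 * e.
Proof.
move=> n1 yw y'w yy' hx.
have e0 : 0 <= e by exact: le_trans yy'.
have [_ _ h] := layers_dist yy'.
have [_ _ h'] := layers_le y'w.
(* The first map and the [n.-1] middle ones make [n] affine maps before the last; [1 <= n] enters
   through the truncated predecessor. *)
have sn : (size (enum 'I_n.-1)).+1 = n by rewrite size_enum_ord prednK.
rewrite /Phi -!/(hidden _ _ _).
apply: le_trans (affine_map_dist (B := lip_base w ^+ n)
   (D := L * (lip_base w ^+ n * e)) _ h' _ h _) _.
- by move=> j; rewrite mxE sigma_hidden_le// -[n in _ ^+ n]sn hidden_bound.
- move=> j; rewrite !mxE (le_trans (sigma_lip _ _))// ler_pM2l//.
    by rewrite -[n in _ ^+ n]sn hidden_dist.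
  exact: lt_le_trans ltr01 L1.
- by rewrite exprS layer_dist_step// exprn_ege1// lip_base_ge1.
Qed.

(** * Continuity of the networks in the input *)

Lemma continuous_affine_map (T : topologicalType) p k (M : 'M[R]_(p, k + 1))
    (z : T -> 'cV[R]_k) i :
  (forall j, continuous (fun x => z x j 0)) ->
  continuous (fun x => affine_map M (z x) i 0).
Proof.
move=> hz; under eq_fun do rewrite affine_mapE.
move=> x; apply: cvgD; last exact: cvg_cst.
move: x; apply: (@continuous_big _ _ +%R 0 predT) => [|j _].
  exact: add_continuous.
by move=> x; apply: cvgM; [exact: cvg_cst|exact: hz].
Qed.

Lemma lipschitz_continuous : continuous sigma.
Proof.
have L0 : 0 < L by exact: lt_le_trans L1.
move=> t; apply/cvgrPdist_le => e e0; near=> s.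
apply: le_trans (sigma_lip _ _) _; rewrite -ler_pdivlMl// mulrC.
near: s; apply: (@cvgr_dist_le _ _ _ (nbhs t) _ id t) => //.
by rewrite divr_gt0.
Unshelve. all: end_near. Qed.

Lemma hidden_continuous y s i : continuous (fun x => hidden y s x i 0).
Proof.
elim/last_ind: s i => [|s l IH] i.
  by apply: continuous_affine_map => j; exact: coord_continuous.
under eq_fun do rewrite hidden_rcons.
apply: continuous_affine_map => j; under eq_fun do rewrite mxE.
move=> x; apply: (@continuous_comp _ _ _ (fun x => hidden y s x j 0)).
  exact: IH.
exact: lipschitz_continuous.
Qed.

(** Needed because linearity and boundedness of the embedding are given only for functions
    continuous on the cube. *)
Lemma Phi_continuous y : continuous (Phi sigma y).
Proof.
apply: continuous_affine_map => j; under eq_fun do rewrite mxE.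
move=> x; apply: (@continuous_comp _ _ _ (fun x => hidden y _ x j 0)).
  exact: hidden_continuous.
exact: lipschitz_continuous.
Qed.

End Lipschitz.

(** * Entropy of a class approximated by networks *)

Lemma interval_net (R : realType) (N : nat) (w : R) : (0 < N)%N -> 0 < w ->
  exists t : 'I_N -> R, (forall j, `|t j| <= w) /\
    forall s, `|s| <= w -> exists j, `|s - t j| <= w / N%:R.
Proof.
case: N => // N _ w0; have N0 : (0 : R) < N.+1%:R by rewrite ltr0n.
(* Midpoints of the [N.+1] equal subintervals of [[-w, w]]. *)
exists (fun j => w / N.+1%:R * ((2 * j + 1)%:R - N.+1%:R)); split=> [j|s sw].
  have jN : (j.+1 <= N.+1)%N by [].
  rewrite normrM gtr0_norm ?divr_gt0// -[leRHS](divfK (lt0r_neq0 N0)).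
  rewrite ler_pM2l ?divr_gt0// ler_norml natrD natrM.
  rewrite -(ler_nat R) -natr1 in jN; have j0 := ler0n R j.
  by apply/andP; split; lra.
move: sw; rewrite ler_norml => /andP[ws sw].
(* Position of [s] measured from [-w] in units of the subinterval length. *)
pose r := (s / w + 1) * N.+1%:R / 2.
have sE : s = w / N.+1%:R * (2 * r - N.+1%:R).
  by rewrite /r; field; rewrite lt0r_neq0//= addrC natr1 lt0r_neq0.
have r0 : 0 <= r.
  by rewrite divr_ge0// mulr_ge0// -lerBlDr sub0r ler_pdivlMr// mulN1r.
have rN : r <= N.+1%:R.
  rewrite ler_pdivrMr// [leRHS]mulrC ler_pM2r//.
  by rewrite -lerBrDr ler_pdivrMr// (_ : 2 - 1 = 1 :> R) ?mul1r//; ring.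
suff [j [jr rj]] : exists j : 'I_N.+1, j%:R <= r /\ r <= j.+1%:R.
  exists j; rewrite [s in X in X <= _]sE -mulrBr normrM gtr0_norm ?divr_gt0//.
  rewrite -[leRHS]mulr1 ler_pM2l ?divr_gt0// ler_norml natrD natrM.
  by rewrite -natr1 in rj; apply/andP; split; lra.
have /andP[h1 h2] := truncn_itv r0.
have [tN|Nt] := ltnP (Num.truncn r) N.+1.
  by exists (Ordinal tN); split => //; exact: ltW.
(* Only the right endpoint [r = N.+1] remains; it goes to the last subinterval. *)
exists ord_max; split => //=; apply: le_trans h1.
by rewrite ler_nat ltnW.
Qed.

(** Product of one-dimensional grids: in the max norm coordinatewise errors do not add up. The grid
    stays in the ball, as the Lipschitz estimate requires. *)
Lemma mx_ball_net (R : realType) (N P : nat) (w : R) : (0 < N)%N -> 0 < w ->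
  exists Y : 'I_(N ^ P) -> 'rV[R]_P, (forall i, `|Y i| <= w) /\
    forall y, `|y| <= w -> exists i, `|y - Y i| <= w / N%:R.
Proof.
move=> N0 w0; have [t [tw tP]] := interval_net N0 w0.
have cardE : #|{ffun 'I_P -> 'I_N}| = (N ^ P)%N by rewrite card_ffun !card_ord.
pose g i : {ffun 'I_P -> 'I_N} := enum_val (cast_ord (esym cardE) i).
exists (fun i => \row_j t (g i j)); split=> [i|y yw].
  by apply/(mx_norm_leP _ (ltW w0)) => a b; rewrite mxE.
have /(mx_norm_leP _ (ltW w0)) {}yw := yw.
have [f fP] := choice (fun j => tP (y 0 j) (yw 0 j)).
exists (cast_ord cardE (enum_rank (finfun f))).
have wN0 : 0 <= w / N%:R by rewrite divr_ge0// ltW.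
by apply/(mx_norm_leP _ wN0) => a b; rewrite ord1 !mxE /g cast_ordK enum_rankK ffunE.
Qed.

Section Entropy.
Variables (R : realType) (d W : nat) (X : normedModType R).
Variable iota : ('cV[R]_d -> R) -> X.

Lemma embedding_dist (c B : R) (f g : 'cV[R]_d -> R) :
  (forall (a : R) (f g : 'cV[R]_d -> R), cts_on_cube f -> cts_on_cube g ->
     iota (fun x => a * f x + g x) = a *: iota f + iota g) ->
  0 < c ->
  (forall f : 'cV[R]_d -> R, cts_on_cube f -> `|iota f| <= c * sup_norm f) ->
  continuous f -> continuous g -> (forall x, cube R d x -> `|f x - g x| <= B) ->
  `|iota f - iota g| <= c * B.
Proof.
move=> lin c0 bnd cf cg fgB.
have -> : iota f - iota g = iota (fun x => -1 * g x + f x).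
  by rewrite lin ?scaleN1r 1?addrC//; exact: continuous_subspaceT.
apply: le_trans (bnd _ _) _.
  apply: continuous_subspaceT.
  under eq_fun do rewrite mulN1r addrC.
  by move=> x; apply: (continuousB (cf x) (cg x)).
rewrite ler_pM2l//; apply: ge_sup; last first.
  by move=> _ [x xc <-]; rewrite mulN1r addrC; exact: fgB.
by exists `|-1 * g 0 + f 0|; exists 0 => // i; rewrite mxE lexx ler01.
Qed.

Variables (sigma : R -> R) (K : set X).

(** The strict inequality yields an actual network although the infimum need not be attained. *)
Lemma class_error_ltE n (w t : R) (f : X) : K f ->
  (class_error W iota sigma K n w < t%:E)%E ->
  exists2 y : 'rV[R]_(num_params d W n),
    `|y| <= w & `|f - iota (Phi sigma y)| < t.
Proof.
move=> Kf ht; have : (approx_error W iota sigma n w f < t%:E)%E.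
  by apply: le_lt_trans ht; apply: ereal_sup_ubound; exists f.
by move=> /ereal_inf_lt[_ [y yw <-]]; rewrite lte_fin; exists y.
Qed.

Lemma class_error_antitone n (w w' : R) : w <= w' ->
  (class_error W iota sigma K n w' <= class_error W iota sigma K n w)%E.
Proof.
move=> ww'; apply: ge_ereal_sup => _ [f Kf <-].
apply: le_trans (ereal_sup_ubound _); last by exists f; [exact: Kf|reflexivity].
apply: ereal_inf_le_tmp => _ [y yw <-]; exists y => //.
exact: le_trans yw ww'.
Qed.

Hypothesis hiota : continuous_embedding iota.
Hypothesis W1 : (1 <= W)%N.
Hypothesis sigma_bound : forall t, `|sigma t| <= Num.max 1 `|t|.
Variable L : R.
Hypothesis L1 : 1 <= L.
Hypothesis sigma_lip : forall t s, `|sigma t - sigma s| <= L * `|t - s|.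

(** Triangle inequality through a near-best network [y] and the grid network next to it. Taking
    [2 ^ k] grid values per parameter gives the index [k * num_params d W n]; [c] is the norm bound
    of the embedding. *)
Lemma entropy_le_net : exists2 c : R, 0 < c & forall n k (w t : R),
  (1 <= n)%N -> 1 <= w -> 0 < t ->
  (class_error W iota sigma K n w < t%:E)%E ->
  (entropy_number K (k * num_params d W n) <=
   (t + c * (lip_base d W L w ^+ n.+1 * (w / 2 ^+ k)))%:E)%E.
Proof.
have [lin _ [c c0 bnd]] := hiota.
exists c => // n k w t n1 w1 t0 ht; have w0 : 0 < w by exact: lt_le_trans w1.
have N0 : (0 < 2 ^ k)%N by rewrite expn_gt0.
have [Y [Yw YP]] := mx_ball_net (num_params d W n) N0 w0.
have e0 : 0 <= c * (lip_base d W L w ^+ n.+1 * (w / 2 ^+ k)).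
  have q0 := le_trans ler01 (lip_base_ge1 d L1 w1 W1).
  by rewrite !mulr_ge0 ?exprn_ge0 ?invr_ge0 ?exprn_ge0// ltW.
apply: ereal_inf_lbound => /=; exists (t + c * (lip_base d W L w ^+ n.+1 * (w / 2 ^+ k))) => //.
split; first by rewrite ltr_pwDl.
have E : (2 ^ (k * num_params d W n) = (2 ^ k) ^ num_params d W n)%N by rewrite expnM.
exists (fun i => iota (Phi sigma (Y (cast_ord E i)))) => f Kf.
have [y yw yt] := class_error_ltE Kf ht.
have [i yi] := YP y yw.
exists (cast_ord (esym E) i) => //=.
rewrite cast_ordKV -ball_normE /= distrC.
rewrite -[X in `|X|](subrKA (iota (Phi sigma y))) (le_lt_trans (ler_normD _ _))//.
rewrite ltr_leD//.
apply: embedding_dist => //.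
- exact: Phi_continuous sigma_lip _.
- exact: Phi_continuous sigma_lip _.
move=> x xc; apply: (Phi_dist sigma_bound) => //.
by rewrite -natrX.
Qed.

(** [p] is an integer stand-in for [1 + log2 w]. The two-sided bound on [m] makes [log2 m]
    comparable to the target logarithm, whatever the sign of its exponent. *)
Lemma entropy_le_class_error : exists (M : nat) (c : R), [/\ (0 < M)%N, 0 < c &
  forall n p (w t : R), (1 <= n)%N -> (1 <= p)%N -> 1 <= w <= 2 ^+ p -> 0 < t ->
  (class_error W iota sigma K n w < t%:E)%E ->
  exists2 m, (n ^ 2 * p <= m <= M * (n ^ 2 * p))%N &
    (entropy_number K m <= (t + c * 2 ^- (n * p))%:E)%E].
Proof.
have [c c0 net] := entropy_le_net.
(* [2 ^ a] dominates the part of [lip_base] free of the weight bound. *)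
pose a := (Num.truncn (3 * (d%:R + 1) * (L * W%:R))).+1.
have ha : 3 * (d%:R + 1) * (L * W%:R) <= 2 ^+ a.
  apply: ltW; apply: (@lt_trans _ _ a%:R); last first.
    by rewrite -natrX ltr_nat ltn_expl.
  have h : 0 <= 3 * (d%:R + 1) * (L * W%:R).
    by rewrite !mulr_ge0// ?addr_ge0// (le_trans ler01).
  by have /andP[] := truncn_itv h.
(* The first factor bounds [k / (n p)], the second [num_params d W n / n]. *)
exists ((2 * a + 4) * (W * (d + 1) + W * (W + 1) + (W + 1)))%N, c; split => //.
  by rewrite muln_gt0 !addn1 !addnS.
move=> n p w t n1 p1 /andP[w1 wp] t0 ht.
(* The first summand cancels the Lipschitz constant, the second the radius [w], and the third leaves
   the error [2 ^- (n * p)]. *)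
pose k := ((a + p) * n.+1 + p + n * p)%N.
have w0 : 0 < w by exact: lt_le_trans w1.
exists (k * num_params d W n)%N; last first.
  apply: le_trans (net n k w t n1 w1 t0 ht) _.
  rewrite lee_fin lerD2l ler_pM2l// mulrA ler_pdivrMr ?exprn_gt0//.
  have -> : 2 ^- (n * p) * 2 ^+ k = (2 ^+ ((a + p) * n.+1) * 2 ^+ p : R).
    by rewrite mulrC /k exprD mulfK ?expf_neq0// exprD.
  have q0 : 0 <= lip_base d W L w.
    exact: le_trans ler01 (lip_base_ge1 d L1 w1 W1).
  rewrite ler_pM ?exprn_ge0 ?(ltW w0)//.
  rewrite exprM lerXn2r ?nnegrE ?exprn_ge0//.
  rewrite /lip_base (mulrA _ _ w) exprD ler_pM ?(ltW w0)//.
  by rewrite !mulr_ge0// ?addr_ge0// (le_trans ler01).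
have kle : (k <= (2 * a + 4) * (n * p))%N by rewrite /k; nia.
have kge : (n * p <= k)%N by rewrite /k leq_addl.
have Ple : (num_params d W n <= (W * (d + 1) + W * (W + 1) + (W + 1)) * n)%N.
  rewrite /num_params !mulnDl; apply: leq_add; [apply: leq_add|].
  - by rewrite leq_pmulr.
  - by rewrite mulnC leq_mul2l leq_pred orbT.
  - by rewrite -mulnDl leq_pmulr.
have Pge : (n <= num_params d W n)%N.
  rewrite /num_params.
  have : (n.-1 * 1 <= n.-1 * (W * (W + 1)))%N by rewrite leq_mul2l muln_gt0 W1 addn1 orbT.
  by rewrite muln1; lia.
apply/andP; split.
  have -> : (n ^ 2 * p = (n * p) * n)%N by lia.
  exact: leq_mul.
have -> : (n ^ 2 * p = (n * p) * n)%N by lia.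
by rewrite mulnACA leq_mul.
Qed.

End Entropy.

(** * Asymptotic comparison of the rates *)

Section Log2.
Variable R : realType.
Implicit Types x y : R.

Lemma ln2_gt0 : 0 < ln 2 :> R.
Proof. by apply: ln_gt0; rewrite ltr1n. Qed.

Lemma ln2_ge_half : 1 / 2 <= ln 2 :> R.
Proof.
have : -1 < -(1 / 2) :> R by lra.
move=> /le_ln1Dx; rewrite (_ : 1 + - (1 / 2) = 2^-1 :> R); last by field.
by rewrite lnV ?posrE//; lra.
Qed.

Lemma log2M x y : 0 < x -> 0 < y -> log2 (x * y) = log2 x + log2 y.
Proof. by move=> x0 y0; rewrite /log2 lnM ?posrE// mulrDl. Qed.

Lemma log2_powR x a : log2 (x `^ a) = a * log2 x.
Proof. by rewrite /log2 ln_powR mulrA. Qed.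

Lemma log2_2 : log2 2 = 1 :> R.
Proof. by rewrite /log2 divff// lt0r_neq0// ln2_gt0. Qed.

Lemma le_log2 x y : 0 < x -> x <= y -> log2 x <= log2 y.
Proof.
move=> x0 xy; rewrite /log2 ler_pM2r ?invr_gt0 ?ln2_gt0// ler_ln ?posrE//.
exact: lt_le_trans xy.
Qed.

Lemma log2_ge0 x : 1 <= x -> 0 <= log2 x.
Proof. by move=> x1; apply: divr_ge0; [exact: ln_ge0|exact: ltW ln2_gt0]. Qed.

Lemma log2_ge1 x : 2 <= x -> 1 <= log2 x.
Proof. by move=> x2; rewrite -log2_2 le_log2. Qed.

Lemma log2_le x : 0 < x -> log2 x <= 2 * x.
Proof.
move=> x0; rewrite /log2 ler_pdivrMr ?ln2_gt0//.
have : -1 < x - 1 by lra.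
move=> /le_ln1Dx; rewrite addrC subrK => h.
apply: le_trans h _; have := ln2_ge_half; nra.
Qed.

Lemma ge_log2_exp x (p : nat) : 0 < x -> log2 x <= p%:R -> x <= 2 ^+ p.
Proof.
move=> x0; rewrite /log2 ler_pdivrMr ?ln2_gt0// mulr_natl -lnXn//.
by rewrite ler_ln ?posrE// exprn_gt0.
Qed.

End Log2.

(** * Powers, exponentials and the target rate *)

Section Asymptotics.
Variable R : realType.

Lemma le_powR (a x y : R) : 0 <= a -> 0 < x -> x <= y -> x `^ a <= y `^ a.
Proof.
move=> a0 x0 xy; apply: ge0_ler_powR => //; rewrite nnegrE; first exact: ltW.
exact: le_trans (ltW x0) xy.
Qed.

(** [l] and [V] agree up to the factor [D]; one inequality serves [b >= 0], the other [b < 0]. *)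
Lemma powR_comparable (D V l b : R) : 1 <= D -> 0 < V -> V <= D * l ->
  l <= D * V -> D `^ (- `|b|) * V `^ b <= l `^ b.
Proof.
move=> D1 V0 Vl lV; have D0 : 0 < D by exact: lt_le_trans D1.
have l0 : 0 < l by rewrite -(pmulr_rgt0 _ D0) (lt_le_trans V0).
have [b0|/ltW b0] := leP 0 b.
  rewrite ger0_norm// powRN mulrC ler_pdivrMr ?powR_gt0// -powRM ?(ltW l0) ?(ltW D0)//.
  by rewrite le_powR// mulrC.
rewrite ler0_norm// opprK -powRM ?(ltW V0) ?(ltW D0)//.
rewrite -[b]opprK ![_ `^ (- - b)]powRN lef_pV2 ?posrE ?powR_gt0 ?mulr_gt0//.
by rewrite le_powR// oppr_ge0.
Qed.

(** The term of order [Q.+1] in the series of [exp (s ln 2)] has one power of [s] to spare, which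
    beats any constant for large [s]. *)
Lemma pow_le_exp2 (Q : nat) (e : R) : 0 < e ->
  exists N : nat, forall s, (N <= s)%N -> s%:R ^+ Q <= e * 2 ^+ s.
Proof.
move=> e0; have l0 := @ln2_gt0 R.
pose a : R := e * (ln 2 ^+ Q.+1 / (Q.+1)`!%:R).
have a0 : 0 < a by rewrite mulr_gt0// divr_gt0 ?exprn_gt0// ltr0n fact_gt0.
exists (Num.truncn a^-1).+1 => s Ns.
have sa : a^-1 <= s%:R.
  have /truncn_itv/andP[_ /ltW h] : 0 <= a^-1 by rewrite invr_ge0 ltW.
  by apply: le_trans h _; rewrite ler_nat.
have := expR_ge1Dxn Q (mulr_ge0 (ler0n R s) (ltW l0)).
rewrite expRM_natl lnK ?posrE// => h.
have {h} : (s%:R * ln 2) ^+ Q.+1 / (Q.+1)`!%:R <= 2 ^+ s :> R.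
  by apply: le_trans h; rewrite lerDr.
move=> h; apply: (@le_trans _ _ (e * ((s%:R * ln 2) ^+ Q.+1 / (Q.+1)`!%:R))).
  2: by rewrite ler_pM2l.
have -> : e * ((s%:R * ln 2) ^+ Q.+1 / (Q.+1)`!%:R) = s%:R ^+ Q * (s%:R * a).
  by rewrite exprMn exprS /a; ring.
by rewrite ler_peMr ?exprn_ge0// -ler_pdivrMr// mul1r.
Qed.

Lemma gtrsim_le (A : nat -> \bar R) (B B' : nat -> R) (c : R) : 0 < c ->
  (\forall n \near \oo, c * B' n <= B n) -> gtrsim A B -> gtrsim A B'.
Proof.
move=> c0 BB' [e e0 AB]; exists (e * c); first exact: mulr_gt0.
near=> n; apply: (@le_trans _ _ (e * B n)%:E); last by near: n.
by rewrite lee_fin -mulrA ler_pM2l//; near: n.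
Unshelve. all: end_near. Qed.

Lemma gtrsim_eq (A : nat -> \bar R) (B B' : nat -> R) :
  (\forall n \near \oo, B n = B' n) -> gtrsim A B -> gtrsim A B'.
Proof.
move=> BB'; apply: (gtrsim_le ltr01); near=> n.
by rewrite mul1r le_eqVlt; apply/orP; left; apply/eqP/esym; near: n.
Unshelve. all: end_near. Qed.

(** With [u = 1 + log2 (w n)] this is the lower bound asserted for general [w]. *)
Definition rate (alpha beta : R) (n : nat) (u : R) : R :=
  (log2 n%:R + log2 u) `^ beta / (n%:R ^+ 2 * u) `^ alpha.

Lemma rate_gt0 alpha beta n u : (2 <= n)%N -> 1 <= u -> 0 < rate alpha beta n u.
Proof.
move=> n2 u1; have n0 : (0 : R) < n%:R by rewrite ltr0n; exact: leq_trans n2.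
have u0 : 0 < u by exact: lt_le_trans u1.
rewrite divr_gt0 ?powR_gt0//; last by rewrite mulr_gt0// exprn_gt0.
by rewrite ltr_pwDl ?log2_ge0// (lt_le_trans ltr01)// log2_ge1// ler_nat.
Qed.

(** If [m] is of order [n ^ 2 u], then [log2 m] is of order [log2 n + log2 u]. The threshold for [n]
    is uniform in [u] and [m], as the growth of [w] is arbitrary. *)
Lemma rate_le_entropy_rate (alpha beta : R) (M : nat) : 0 <= alpha -> (0 < M)%N ->
  exists2 c : R, 0 < c & \forall n \near \oo, forall (u : R) (m : nat),
    1 <= u -> n%:R ^+ 2 * u <= 2 * m%:R -> m%:R <= M%:R * (n%:R ^+ 2 * u) ->
    c * rate alpha beta n u <= log2 m%:R `^ beta / m%:R `^ alpha.
Proof.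
move=> a0 M0; have M0' : (0 : R) < M%:R by rewrite ltr0n.
exists (3 `^ (- `|beta|) / M%:R `^ alpha); first by rewrite divr_gt0 ?powR_gt0.
(* [n >= 2] absorbs the factor 2 in the lower bound on [m]; [n >= M] bounds [log2 M] by [log2 n],
   whence the constant 3. *)
exists (maxn 2 M) => // n /=; rewrite geq_max => /andP[n2 Mn] u m u1 h1 h2.
have n2' : (2 : R) <= n%:R by rewrite ler_nat.
have Mn' : (M%:R : R) <= n%:R by rewrite ler_nat.
have n0 : (0 : R) < n%:R by lra.
have u0 : 0 < u by lra.
have nu0 : 0 < n%:R ^+ 2 * u by rewrite mulr_gt0// exprn_gt0.
have m0 : (0 : R) < m%:R by lra.
have l1 : log2 n%:R + log2 u <= log2 m%:R :> R.
  rewrite -log2M// le_log2 ?mulr_gt0//.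
  have : 2 * (n%:R * u) <= n%:R ^+ 2 * u by rewrite expr2 -mulrA ler_pM2r// mulr_gt0.
  by move: h1; lra.
have l2 : log2 m%:R <= 3 * (log2 n%:R + log2 u) :> R.
  apply: le_trans (le_log2 m0 h2) _.
  have := le_log2 M0' Mn'; have := log2_ge0 u1.
  by rewrite expr2 !log2M ?mulr_gt0//; lra.
have V1 : 1 <= log2 n%:R + log2 u.
  by have := log2_ge1 n2'; have := log2_ge0 u1; lra.
have h : 3 `^ (- `|beta|) * (log2 n%:R + log2 u) `^ beta <= log2 m%:R `^ beta.
  by apply: powR_comparable => //; lra.
have -> : 3 `^ (- `|beta|) / M%:R `^ alpha * rate alpha beta n u =
  3 `^ (- `|beta|) * (log2 n%:R + log2 u) `^ beta / (M%:R * (n%:R ^+ 2 * u)) `^ alpha.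
  by rewrite /rate (powRM _ (ltW M0') (ltW nu0)) invfM; ring.
rewrite ler_pM ?mulr_ge0 ?invr_ge0 ?powR_ge0//.
rewrite lef_pV2 ?posrE ?powR_gt0// ?mulr_gt0//.
exact: le_powR.
Qed.

(** With [s = n p] the rate is at least [4 s] to the power [- g], and [2 ^ s] outgrows every power
    of [s]. *)
Lemma exp_le_rate (alpha beta e : R) : 0 <= alpha -> 0 < e ->
  \forall n \near \oo, forall (u : R) (p : nat), 1 <= u -> (1 <= p)%N ->
    u <= 2 * p%:R -> 2 ^- (n * p) <= e * rate alpha beta n u.
Proof.
move=> a0 e0; pose g := `|beta| + 2 * alpha; pose Q := (Num.truncn g).+1.
have g0 : 0 <= g by rewrite addr_ge0 ?mulr_ge0.
have gQ : g <= Q%:R by have /andP[_ /ltW] := truncn_itv g0.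
have e'0 : 0 < e / 4 ^+ Q by rewrite divr_gt0// exprn_gt0.
have [N hN] := pow_le_exp2 Q e'0.
exists (maxn 2 N) => // n /=; rewrite geq_max => /andP[n2 Nn] u p u1 p1 up.
have n2' : (2 : R) <= n%:R by rewrite ler_nat.
have p1' : (1 : R) <= p%:R by rewrite ler1n.
pose s : R := n%:R * p%:R.
have s2 : 2 <= s by rewrite /s; nra.
have nus : n%:R * u <= 2 * s by rewrite /s; nra.
have nu0 : 0 < n%:R ^+ 2 * u by rewrite mulr_gt0 ?exprn_gt0//; lra.
have s40 : 0 < 4 * s by lra.
have V1 : 1 <= log2 n%:R + log2 u.
  by have := log2_ge1 n2'; have := log2_ge0 u1; lra.
have V4 : log2 n%:R + log2 u <= 4 * s.
  rewrite -log2M; [|lra|lra].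
  by apply: le_trans (log2_le _) _; [rewrite mulr_gt0; lra|lra].
(* Only [1 <= log2 n + log2 u <= 4 s] is known, hence the comparison with [V = 1] and
   [D = 4 * s]. *)
have num : (4 * s) `^ (- `|beta|) <= (log2 n%:R + log2 u) `^ beta.
  have := @powR_comparable (4 * s) 1 (log2 n%:R + log2 u) beta.
  by rewrite powR1 !mulr1; apply; nra.
have den : (n%:R ^+ 2 * u) `^ alpha <= (4 * s) `^ (2 * alpha).
  rewrite powRrM (@powR_mulrn _ (4 * s) 2); last lra.
  apply: le_powR => //.
  apply: (@le_trans _ _ (n%:R * (2 * s))); first by rewrite expr2 -mulrA ler_pM2l//; lra.
  have : n%:R <= s by rewrite /s; nra.
  by rewrite expr2; nra.
have lb : (4 * s) `^ (- g) <= rate alpha beta n u.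
  rewrite /g opprD powRD; last by apply/implyP => _; apply/eqP; lra.
  rewrite [X in _ * X]powRN ler_pM ?invr_ge0 ?powR_ge0// lef_pV2 ?posrE ?powR_gt0//.
rewrite -(ler_pM2l e0) in lb; apply: le_trans lb.
apply: (@le_trans _ _ (e * (4 * s) `^ (- Q%:R))); last first.
  by rewrite ler_pM2l// ler_powR ?lerN2//; lra.
rewrite powRN powR_mulrn; last lra.
have Ns : (N <= n * p)%N by apply: leq_trans Nn _; rewrite leq_pmulr.
have := hN _ Ns; rewrite natrM -/s.
move=> h; rewrite ler_pdivlMr ?exprn_gt0// ler_pdivrMl ?exprn_gt0//.
rewrite exprMn -ler_pdivlMl ?exprn_gt0//; apply: le_trans h _.
by rewrite -mulrA mulrCA (mulrC e).
Qed.

End Asymptotics.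

(** * Lower bounds for the class error *)

Section Main.
Variables (R : realType) (d W : nat) (X : normedModType R).
Variable iota : ('cV[R]_d -> R) -> X.
Hypothesis hiota : continuous_embedding iota.
Hypothesis W1 : (1 <= W)%N.
Variables (sigma : R -> R) (K : set X) (L : R).
Hypothesis sigma_bound : forall t, `|sigma t| <= Num.max 1 `|t|.
Hypothesis L1 : 1 <= L.
Hypothesis sigma_lip : forall t s, `|sigma t - sigma s| <= L * `|t - s|.
Variables (alpha beta : R).
Hypothesis alpha0 : 0 <= alpha.
Hypothesis hK : gtrsim (entropy_number K)
  (fun n => log2 n%:R `^ beta / n%:R `^ alpha).

(* If the class error were too small, the covering of K above would contradict
   the lower bound on the entropy number of index m, which is of the order of
   [n ^ 2 * (1 + log2 (w n))]. *)
Lemma class_error_rate (w : nat -> R) : (forall n, (1 <= n)%N -> 1 <= w n) ->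
  gtrsim (fun n => class_error W iota sigma K n (w n))
    (fun n => rate alpha beta n (1 + log2 (w n))).
Proof.
move=> w1; have [M [c [M0 c0 ent]]] :=
  entropy_le_class_error K hiota W1 sigma_bound L1 sigma_lip.
have [c1 c1_gt0 [N1 _ hN1]] := hK.
have M20 : (0 < 2 * M)%N by rewrite muln_gt0.
have [c2 c2_gt0 [N2 _ hN2]] := rate_le_entropy_rate beta alpha0 M20.
(* One third of the lower bound goes to the class error and one third to the grid error; the
   remaining third makes the contradiction strict. *)
have e0 : 0 < c1 * c2 / 3 by rewrite divr_gt0// mulr_gt0.
have e1 : 0 < c1 * c2 / 3 / c by rewrite divr_gt0.
have [N3 _ hN3] := exp_le_rate beta alpha0 e1.
exists (c1 * c2 / 3) => //.
exists (maxn 2 (maxn N1 (maxn N2 N3))) => // n /=.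
rewrite !geq_max => /and4P[n2 nN1 nN2 nN3].
have n1 : (1 <= n)%N by exact: leq_trans n2.
set u := 1 + log2 (w n).
have u1 : 1 <= u by rewrite lerDl log2_ge0// w1.
(* The integer part satisfies [p <= u <= 2 p], and [log2 (w n) = u - 1 < p] gives [w n <= 2 ^ p]. *)
pose p := Num.truncn u.
have /andP[pu up] : p%:R <= u < p.+1%:R by apply: truncn_itv; lra.
have p1 : (1 <= p)%N by rewrite truncn_gt0.
have p1' : (1 : R) <= p%:R by rewrite ler1n.
have u2p : u <= 2 * p%:R by rewrite -natr1 in up; lra.
have wp : 1 <= w n <= 2 ^+ p.
  rewrite w1//= ge_log2_exp// ?(lt_le_trans ltr01 (w1 _ n1))//.
  by rewrite -natr1 /u in up; lra.
have B0 : 0 < rate alpha beta n u by exact: rate_gt0.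
have t0 : 0 < c1 * c2 / 3 * rate alpha beta n u by exact: mulr_gt0.
rewrite leNgt; apply/negP => lt_error.
have [m /andP[m1 m2] hm] := ent n p (w n) _ n1 p1 wp t0 lt_error.
have n0 : (0 : R) < n%:R ^+ 2 by rewrite exprn_gt0// ltr0n.
(* The index [m] is at least [n], so the eventual lower bound on the entropy numbers applies to
   it. *)
have nm : (n <= m)%N.
  apply: leq_trans m1; rewrite expnS expn1 -mulnA leq_pmulr// muln_gt0.
  by rewrite n1.
have := hN1 m (leq_trans nN1 nm).
move=> /le_trans /(_ hm); rewrite lee_fin; apply/negP; rewrite -ltNge.
have h2 := hN2 n nN2 u m u1.
have h3 := hN3 n nN3 u p u1 p1 u2p.
rewrite -(ler_nat R) natrM natrX in m1.
rewrite -(ler_nat R) 2!natrM natrX in m2.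
have {h2} : c2 * rate alpha beta n u <= log2 m%:R `^ beta / m%:R `^ alpha.
  apply: h2.
    apply: (@le_trans _ _ (n%:R ^+ 2 * (2 * p%:R))); first by rewrite ler_pM2l.
    by rewrite mulrCA ler_pM2l.
  have pu' : M%:R * (n%:R ^+ 2 * p%:R) <= M%:R * (n%:R ^+ 2 * u).
    by rewrite ler_pM2l ?ltr0n// ler_pM2l.
  rewrite [(2 * M)%:R]natrM -mulrA; apply: le_trans m2 (le_trans pu' _).
  rewrite ler_peMl ?ler1n// mulr_ge0//; apply: mulr_ge0; first exact: ltW.
  exact: le_trans u1.
rewrite -(ler_pM2l c1_gt0) => h2; apply: lt_le_trans h2.
rewrite -(ler_pM2l c0) in h3.
have E : c * (c1 * c2 / 3 / c * rate alpha beta n u) =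
  c1 * c2 / 3 * rate alpha beta n u by field; rewrite lt0r_neq0.
rewrite E in h3.
have -> : c1 * (c2 * rate alpha beta n u) = 3 * (c1 * c2 / 3 * rate alpha beta n u).
  by field.
apply: le_lt_trans (_ : _ <= 2 * (c1 * c2 / 3 * rate alpha beta n u)) _.
  by rewrite [leRHS]mulr_natl mulr2n lerD2l.
by rewrite ltr_pM2r// ltr_nat.
Qed.

(* The majorant [w'] makes up for [w n < 1], which [C < 1] allows. *)
Lemma class_error_rate_growth (w w' : nat -> R) (g : nat -> R) (D k : R) :
  (forall n, (1 <= n)%N -> 1 <= w' n) -> 1 <= D -> 0 <= k ->
  (\forall n \near \oo, [/\ w n <= w' n, 1 <= g n, g n <= n%:R `^ k &
      1 + log2 (w' n) <= D * g n]) ->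
  gtrsim (fun n => class_error W iota sigma K n (w n))
    (fun n => log2 n%:R `^ beta / (n%:R ^+ 2 * g n) `^ alpha).
Proof.
move=> w'1 D1 k0 [N _ hN].
have D0 : 0 < D by exact: lt_le_trans D1.
(* [log2 u <= (1 + k) log2 n] leads to the base [2 + k], and [u <= D g] to the power of [D]. *)
have c0 : 0 < (2 + k) `^ (- `|beta|) / D `^ alpha.
  by rewrite divr_gt0 ?powR_gt0//; lra.
have mono : gtrsim (fun n => class_error W iota sigma K n (w n))
    (fun n => rate alpha beta n (1 + log2 (w' n))).
  have [c c_gt0 [N' _ hN']] := class_error_rate w'1.
  exists c => //; exists (maxn N N') => // n /=; rewrite geq_max => /andP[nN nN'].
  apply: le_trans (hN' _ nN') _.
  by apply: class_error_antitone; have [] := hN n nN.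
apply: gtrsim_le c0 _ mono.
exists (maxn 2 (maxn N (Num.truncn D).+1)) => // n /=.
rewrite !geq_max => /and3P[n2 nN nD].
have [_ g1 gk ug] := hN n nN.
have n1 : (1 <= n)%N by exact: leq_trans n2.
have u1 : 1 <= 1 + log2 (w' n) by rewrite lerDl log2_ge0// w'1.
set u := 1 + log2 (w' n) in u1 ug *.
have n2' : (2 : R) <= n%:R by rewrite ler_nat.
have l1 := log2_ge1 n2'.
have Dn : D <= n%:R.
  have /andP[_ /ltW h] := truncn_itv (ltW D0).
  by apply: le_trans h _; rewrite ler_nat.
have n0 : (0 : R) < n%:R by lra.
have n20 : (0 : R) < n%:R ^+ 2 by rewrite exprn_gt0.
have lu : log2 u <= (1 + k) * log2 n%:R.
  have h : D * g n <= n%:R * n%:R `^ k by apply: ler_pM => //; lra.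
  have u0 : 0 < u by lra.
  apply: le_trans (le_log2 u0 (le_trans ug h)) _.
  by rewrite log2M ?powR_gt0// log2_powR; lra.
have lu0 := log2_ge0 u1.
have num : (2 + k) `^ (- `|beta|) * log2 n%:R `^ beta <=
    (log2 n%:R + log2 u) `^ beta.
  by apply: powR_comparable; nra.
have ng0 : 0 < n%:R ^+ 2 * g n by rewrite mulr_gt0//; lra.
have -> : (2 + k) `^ (- `|beta|) / D `^ alpha *
    (log2 n%:R `^ beta / (n%:R ^+ 2 * g n) `^ alpha) =
  (2 + k) `^ (- `|beta|) * log2 n%:R `^ beta / (D * (n%:R ^+ 2 * g n)) `^ alpha.
  by rewrite (powRM _ (ltW D0) (ltW ng0)) invfM; ring.
have nu0 : 0 < n%:R ^+ 2 * u by rewrite mulr_gt0//; lra.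
have Dng0 : 0 < D * (n%:R ^+ 2 * g n) by exact: mulr_gt0.
rewrite /rate ler_pM ?mulr_ge0 ?invr_ge0 ?powR_ge0//.
rewrite lef_pV2 ?posrE ?powR_gt0//; apply: le_powR => //.
by rewrite mulrCA ler_pM2l.
Qed.

(** Here [g n = log2 n]: for [n >= 2] it is at least 1 and absorbs the constant [1 + log2 C1];
    [k = 2] since [log2 n <= 2 n <= n ^ 2]. *)
Lemma polynomial_growth (C delta : R) : 0 < C -> 0 < delta ->
  gtrsim (fun n => class_error W iota sigma K n (C * n%:R `^ delta))
    (fun n => log2 n%:R `^ beta / (n%:R ^+ 2 * log2 n%:R) `^ alpha).
Proof.
move=> C0 delta0; pose C1 := Num.max C 1.
have C11 : 1 <= C1 by rewrite le_max lexx orbT.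
have CC1 : C <= C1 by rewrite le_max lexx.
have n1 n : (1 <= n)%N -> 1 <= n%:R `^ delta.
  by move=> n1; rewrite -[leLHS](powRr0 n%:R) ler_powR ?ler1n// ltW.
have lC := log2_ge0 C11.
apply: (@class_error_rate_growth _ (fun n => C1 * n%:R `^ delta) _
          (1 + log2 C1 + delta) 2) => //; [|lra|].
  by move=> n /n1 h; rewrite -[leLHS]mulr1 ler_pM.
exists 2%N => // n /= n2; have n2' : (2 : R) <= n%:R by rewrite ler_nat.
have n0 : (0 : R) < n%:R by lra.
have l1 := log2_ge1 n2'.
split => //.
- by rewrite ler_wpM2r ?powR_ge0.
- by rewrite powR_mulrn//; apply: le_trans (log2_le n0) _; rewrite expr2 ler_pM2r.
- by rewrite log2M ?powR_gt0//; [rewrite log2_powR; nra|lra].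
Qed.

(** Here [g n] is [n] to the power [nu], which is at least 1 and bounds the logarithm of the weight
    bound up to a constant. *)
Lemma exponential_growth (C c nu : R) : 0 < C -> 0 < c -> 0 <= nu ->
  gtrsim (fun n => class_error W iota sigma K n (C * 2 `^ (c * n%:R `^ nu)))
    (fun n => log2 n%:R `^ beta / (n%:R ^+ 2 * n%:R `^ nu) `^ alpha).
Proof.
move=> C0 c0 nu0; pose C1 := Num.max C 1.
have C11 : 1 <= C1 by rewrite le_max lexx orbT.
have CC1 : C <= C1 by rewrite le_max lexx.
have n1 n : (1 <= n)%N -> 1 <= n%:R `^ nu :> R.
  by move=> n1; rewrite -[leLHS](powRr0 n%:R) ler_powR ?ler1n.
have lC := log2_ge0 C11.
apply: (@class_error_rate_growth _ (fun n => C1 * 2 `^ (c * n%:R `^ nu)) _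
          (1 + log2 C1 + c) nu) => //; [|lra|].
  move=> n /n1 h; rewrite -[leLHS]mulr1 ler_pM// -[leLHS](powRr0 2).
  by rewrite ler_powR ?ler1n// mulr_ge0 ?powR_ge0 ?ltW.
exists 1%N => // n /= /n1 h; split => //.
- by rewrite ler_wpM2r ?powR_ge0.
- by rewrite log2M ?powR_gt0//; [rewrite log2_powR log2_2; nra|lra].
Qed.

End Main.

(** * Bounds for the activation and assembly of the statements *)

Lemma admissible_activation_bounds (R : realType) (L : R) (sigma : R -> R) :
  admissible_activation L sigma ->
  (forall t, `|sigma t| <= Num.max 1 `|t|) /\
  (forall t s, `|sigma t - sigma s| <= Num.max L 1 * `|t - s|).
Proof.
case=> [[-> ->]|[s1 sL]].
  (* This form reduces the Lipschitz bound for ReLU to the reverse triangle inequality. *)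
  have reluE (t : R) : relu t = (t + `|t|) / 2.
    rewrite /relu; have [t0|t0] := leP 0 t; first by rewrite ger0_norm//; lra.
    by rewrite ltr0_norm//; lra.
  rewrite maxxx; split=> [t|t s].
    rewrite le_max; apply/orP; right; rewrite reluE normrM [ `|2^-1|]gtr0_norm//.
    by rewrite ler_pdivrMr// (le_trans (ler_normD _ _))// normr_id mulr_natr mulr2n.
  rewrite mul1r !reluE -mulrBl normrM [ `|2^-1|]gtr0_norm// ler_pdivrMr//.
  rewrite opprD addrACA (le_trans (ler_normD _ _))// mulr_natr mulr2n lerD2l.
  exact: ler_dist_dist.
split=> [t|t s]; first by rewrite le_max s1.
by apply: le_trans (sL _ _) _; rewrite ler_wpM2r// le_max lexx.
Qed.

Theorem corollary5p6 (R : realType) (d W : nat) (hd : (1 <= d)%N) (hW : (2 <= W)%N)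
    (X : completeNormedModType R) (iota : ('cV[R]_d -> R) -> X)
    (hiota : continuous_embedding iota)
    (K : set X) (hK : compact K)
    (sigma : R -> R) (L : R) (hsigma : admissible_activation L sigma)
    (alpha beta : R) (halpha : 0 < alpha) :
  (* general bounds on the parameters *)
  (forall w : nat -> R,
     (forall n, (1 <= n)%N -> 1 <= w n /\ 2 <= L * W%:R * w n) ->
     (gtrsim (entropy_number K)
        (fun n => log2 n%:R `^ beta / n%:R `^ alpha) ->
      gtrsim (fun n => class_error W iota sigma K n (w n))
        (fun n => (log2 n%:R + log2 (1 + log2 (w n))) `^ beta
                  / (n%:R ^+ 2 * (1 + log2 (w n))) `^ alpha)) /\
     (gtrsim (entropy_number K)
        (fun n => log2 n%:R `^ (- alpha)) ->
      gtrsim (fun n => class_error W iota sigma K n (w n))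
        (fun n => (log2 n%:R + log2 (1 + log2 (w n))) `^ (- alpha)))) /\
  (* polynomial bounds *)
  (forall C delta : R, 0 < C -> 0 < delta ->
     (gtrsim (entropy_number K)
        (fun n => log2 n%:R `^ beta * n%:R `^ (- alpha)) ->
      gtrsim (fun n => class_error W iota sigma K n (C * n%:R `^ delta))
        (fun n => log2 n%:R `^ (beta - alpha) * n%:R `^ (- (2 * alpha)))) /\
     (gtrsim (entropy_number K)
        (fun n => log2 n%:R `^ (- alpha)) ->
      gtrsim (fun n => class_error W iota sigma K n (C * n%:R `^ delta))
        (fun n => log2 n%:R `^ (- alpha)))) /\
  (* exponential bounds *)
  (forall C c nu : R, 0 < C -> 0 < c -> 0 <= nu ->
     (gtrsim (entropy_number K)
        (fun n => log2 n%:R `^ beta * n%:R `^ (- alpha)) ->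
      gtrsim (fun n => class_error W iota sigma K n (C * 2 `^ (c * n%:R `^ nu)))
        (fun n => log2 n%:R `^ beta * n%:R `^ (- ((2 + nu) * alpha)))) /\
     (gtrsim (entropy_number K)
        (fun n => log2 n%:R `^ (- alpha)) ->
      gtrsim (fun n => class_error W iota sigma K n (C * 2 `^ (c * n%:R `^ nu)))
        (fun n => log2 n%:R `^ (- alpha)))).
Proof.
(* The Lipschitz constant is enlarged to [Num.max L 1]: a sigmoidal [sigma] may
   have [L < 1]. *)
have [sb sl] := admissible_activation_bounds hsigma.
have W1 : (1 <= W)%N by exact: ltnW.
have L1 : 1 <= Num.max L 1 by rewrite le_max lexx orbT.
have powE : (fun n => log2 n%:R `^ beta * n%:R `^ (- alpha)) =
    (fun n => log2 n%:R `^ beta / n%:R `^ alpha) :> (nat -> R).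
  by apply/funext => n; rewrite powRN.
have logE : (fun n => log2 n%:R `^ (- alpha)) =
    (fun n => log2 n%:R `^ (- alpha) / n%:R `^ 0) :> (nat -> R).
  by apply/funext => n; rewrite powRr0 divr1.
have A0 := ltW halpha; have Z0 := lexx (0 : R).
split=> [w hw|]; last split=> [C delta C0 delta0|C c nu C0 c0 nu0].
- have w1 n : (1 <= n)%N -> 1 <= w n by move=> /hw[].
  split=> [hE|]; first by have := class_error_rate hiota W1 sb L1 sl A0 hE w1.
  rewrite logE => hE.
  apply: gtrsim_eq (class_error_rate hiota W1 sb L1 sl Z0 hE w1).
  by near=> n; rewrite /rate powRr0 divr1.
- split=> [|]; [rewrite powE|rewrite {1}logE] => hE.
    apply: gtrsim_eq (polynomial_growth hiota W1 sb L1 sl A0 hE C0 delta0).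
    exists 2%N => // n /= n2.
    have n0 : (0 : R) < n%:R by rewrite ltr0n; exact: leq_trans n2.
    have l0 : 0 < log2 n%:R :> R.
      by apply: lt_le_trans ltr01 _; apply: log2_ge1; rewrite ler_nat.
    (* The logarithm in the denominator, raised to [alpha], lowers the exponent [beta] to
       [beta - alpha]; this needs it nonzero, hence [n >= 2]. *)
    rewrite powRM ?exprn_ge0 ?(ltW l0)// -[_ ^+ 2]powR_mulrn// -powRrM invfM.
    by rewrite powRB ?powRN; [ring|rewrite lt0r_neq0 ?implybT].
  apply: gtrsim_eq (polynomial_growth hiota W1 sb L1 sl Z0 hE C0 delta0).
  by near=> n; rewrite powRr0 divr1.
- split=> [|]; [rewrite powE|rewrite {1}logE] => hE.
    apply: gtrsim_eq (exponential_growth hiota W1 sb L1 sl A0 hE C0 c0 nu0).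
    exists 2%N => // n /= n2.
    have n0 : (0 : R) < n%:R by rewrite ltr0n; exact: leq_trans n2.
    by rewrite -[_ ^+ 2]powR_mulrn// -powRD ?lt0r_neq0 ?implybT// -powRrM powRN.
  apply: gtrsim_eq (exponential_growth hiota W1 sb L1 sl Z0 hE C0 c0 nu0).
  by near=> n; rewrite powRr0 divr1.
Unshelve. all: end_near. Qed.
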